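(* Fix a real number $\gamma$ with $0<\gamma<1$, and suppose that $n=n(d)$ is a sequence of integers with $n=d^{1/\gamma+o(1)}$ as $d\to\infty$. Then, as $d\to\infty$, \[ \Delta_u(d,n)\leq (n-d)^{\left(1-\frac{\gamma}{2}+o(1)\right)\log_2 d}. \] Equivalently, \[ \Delta_u(d,n)\leq (n-d)^{\left(\frac12-\frac{(1-\gamma)^2}{2}+o(1)\right)\log_2(n-d)}. \]
   Context: A polyhedron is a finite intersection of closed half-spaces; it is pointed if it has at least one vertex. The graph of a pointed polyhedron has its vertices as nodes, two of them being adjacent if they are the endpoints of a (bounded) edge of the polyhedron. The diameter of a pointed polyhedron is the diameter of this graph. $\Delta_u(d,n)$ denotes the maximum diameter of a pointed $d$-dimensional polyhedron (bounded or unbounded) with $n$ facets. *)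

(* Defs.v *)
From HB Require Import structures.
From mathcomp Require Import all_boot all_order all_algebra.
From mathcomp Require Import all_classical all_reals all_analysis.
Set Implicit Arguments.
Unset Strict Implicit.
Unset Printing Implicit Defensive.
Import Order.TTheory GRing.Theory Num.Theory.
Import numFieldNormedType.Exports.
Local Open Scope classical_set_scope.
Local Open Scope ring_scope.

Section Polyhedra.
Variables (R : realType) (m : nat).
Implicit Types (P F : set 'cV[R]_m) (v w : 'cV[R]_m).

Definition halfspace (a : 'rV[R]_m) (b : R) : set 'cV[R]_m :=
  [set x | (a *m x) 0 0 <= b].

Definition hyperplane (a : 'rV[R]_m) (b : R) : set 'cV[R]_m :=
  [set x | (a *m x) 0 0 = b].

Definition polyhedron P : Prop :=
  exists (k : nat) (a : 'I_k -> 'rV[R]_m) (b : 'I_k -> R),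
    (forall i, a i != 0) /\ P = \bigcap_(i in [set: 'I_k]) halfspace (a i) (b i).

(* V is the direction space of the affine hull of S; the empty set has no
   dimension in this sense. *)
Definition affine_dim (S : set 'cV[R]_m) (k : nat) : Prop :=
  exists (x0 : 'cV[R]_m) (V : {vspace 'cV[R]_m}),
    [/\ S x0, \dim V = k, (forall x, S x -> x - x0 \in V) &
        forall W : {vspace 'cV[R]_m},
          (forall x, S x -> x - x0 \in W) -> (V <= W)%VS].

(* The case a = 0 is allowed, so P itself is a face of P. *)
Definition face P F : Prop :=
  exists (a : 'rV[R]_m) (b : R),
    P `<=` halfspace a b /\ F = P `&` hyperplane a b.

Definition facet P F : Prop :=
  face P F /\ exists k : nat, affine_dim P k.+1 /\ affine_dim F k.

Definition vertex P v : Prop := face P [set v].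

Definition edge P F : Prop := face P F /\ affine_dim F 1.

Definition pointed P : Prop := exists v, vertex P v.

Definition segment v w : set 'cV[R]_m :=
  [set (1 - t) *: v + t *: w | t in `[0, 1]].

(* A bounded edge is a segment; v != w holds because an edge has dimension 1. *)
Definition adjacent P v w : Prop :=
  [/\ vertex P v, vertex P w & edge P (segment v w)].

(* +oo when no walk joins v to w. *)
Definition graph_dist P v w : \bar R :=
  ereal_inf [set (size p)%:R%:E | p in
    [set p : seq 'cV[R]_m |
      path (fun x y => `[< adjacent P x y >]) v p /\ last v p = w]].

Definition diameter P : \bar R :=
  ereal_sup [set graph_dist P v w | v in vertex P & w in vertex P].

End Polyhedra.

(* The ambient space R^m is arbitrary: a d-dimensional polyhedron need not be
   full-dimensional. The supremum is taken in \bar R, so a real upper bound on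
   it includes the finiteness of all these diameters. *)
Definition Delta_u (R : realType) (d n : nat) : \bar R :=
  ereal_sup [set D | exists (m : nat) (P : set 'cV[R]_m),
    [/\ polyhedron P, pointed P, affine_dim P d,
        ([set F | facet P F] #= `I_n)%card & D = diameter P]].

Definition log2 (R : realType) (x : R) : R := ln x / ln 2.

(* Main.v *)
Require Import Defs.
From HB Require Import structures.
From mathcomp Require Import all_boot all_order all_algebra.
From mathcomp Require Import all_classical all_reals all_analysis.
From mathcomp Require Import ring lra zify.
Set Implicit Arguments.
Unset Strict Implicit.
Unset Printing Implicit Defensive.
Import Order.TTheory GRing.Theory Num.Theory.
Import numFieldNormedType.Exports.
Local Open Scope ring_scope.

(** The bound comes from the Kalai-Kleitman recursion
      f(d, n) <= f(d - 1, n - 1) + 2 f(d, n / 2) + 2,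
    together with f(d, n) <= f(d - 1, n - 1) when n < 2d, for the largest
    distance f(d, n) between two vertices.

    Everything is done on systems of linear equations E and inequalities I,
    which stand for the polyhedron together with a chosen description; the
    dimension is that of the common kernel of E, and n is the number of
    inequalities. Vertices are the feasible points whose tight constraints have
    trivial common kernel, edges join two vertices whose common tight
    constraints have a kernel of dimension 1. Faces and subsystems are then
    obtained by moving an index from I to E or by dropping it, and the argument
    applies directly to polyhedra that are not simple.

    Recursion ([walk_bound]). Grow balls around v and around w in the graph
    and record the inequalities tight somewhere in the ball. While fewer than
    half of the inequalities are recorded, the recorded ones alone define a
    system that has near v the same vertices and edges ([walk_of_reached]), so
    that the ball cannot have a radius larger than f(d, n / 2) unless it is the
    whole graph ([walk_or_reached], which uses that the graph is connected:
    [connected] is the simplex method). Two balls recording half of the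
    inequalities each share one, and the two vertices on which it is tight lie
    on a common facet, of dimension d - 1 and with at most n - 1 inequalities.
    If n < 2d, then v and w already share a facet because at least d
    inequalities are tight at each.

    Reduction to systems ([facet_presentation]). A polyhedron with n facets is
    given, inside its affine hull, by at most n inequalities: in an irredundant
    description distinct inequalities define distinct facets.

    Estimate. For n < 2^s the recursion multiplies the bound by at most
    4 min(d, 2^j) at the j-th doubling, because only the dimensions up to half of
    the number of inequalities contribute a term f(i, n / 2).
    Hence the logarithm of f(d, n) is at most the sum of min(log d, j) over
    j < s up to linear terms, that is log d log n - (log d)^2 / 2 up to
    O(log n) ([Delta_u_budget]). With log n = (1 / gamma + o(1)) log d and
    log (n - d) = log n + O(1), dividing this by log d log (n - d) gives
    1 - gamma / 2, and dividing it by (log (n - d))^2 gives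
    gamma - gamma^2 / 2 = 1 / 2 - (1 - gamma)^2 / 2. *)

(** * Linear systems, basic solutions and their graph *)

(** The ratio test: p is the slack of the constraints and q the rate at which
    it is used up. It serves for constraints of a system, for the homogeneous
    constraints of a cone and, with absolute values as rates, for both
    directions of a line at once. *)
Lemma first_hit (R : realFieldType) (T : finType) (I : {set T}) (p q : T -> R) :
  (forall i, i \in I -> 0 <= p i) -> (exists2 i, i \in I & 0 < q i) ->
  exists (t : R) (i : T),
    [/\ 0 <= t, i \in I, 0 < q i, p i = t * q i &
        forall j, j \in I -> t * q j <= p j].
Proof.
move=> p0 [i0 i0I qi0].
case: (@Order.TotalTheory.arg_minP _ _ _ i0 [pred i | (i \in I) && (0 < q i)]
  (fun i => p i / q i)) => /=; first by rewrite i0I.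
move=> i /andP[iI qi] imin; exists (p i / q i), i; split=> //.
- by rewrite divr_ge0 ?p0 ?ltW.
- by rewrite divfK // gt_eqF.
move=> j jI; case: (ltP 0 (q j)) => [qj|qj].
  by rewrite -ler_pdivlMr // imin // jI.
apply: (le_trans _ (p0 j jI)).
by rewrite mulr_ge0_le0 // divr_ge0 ?p0 ?ltW.
Qed.

Section System.
Import mathcomp.boot.fintype mathcomp.boot.finset.
Variables (R : realFieldType) (m k : nat).
Variables (a : 'I_k -> 'rV[R]_m) (b : 'I_k -> R).
Implicit Types (E I S T : {set 'I_k}) (x y v w u : 'cV[R]_m) (g : 'rV[R]_m).

Definition dot g x : R := (g *m x) 0 0.

Lemma dotD g x y : dot g (x + y) = dot g x + dot g y.
Proof. by rewrite /dot mulmxDr mxE. Qed.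

Lemma dotZ g t x : dot g (t *: x) = t * dot g x.
Proof. by rewrite /dot -scalemxAr mxE. Qed.

Lemma dotN g x : dot g (- x) = - dot g x.
Proof. by rewrite /dot mulmxN mxE. Qed.

Lemma dotB g x y : dot g (x - y) = dot g x - dot g y.
Proof. by rewrite dotD dotN. Qed.

Lemma dot0 g : dot g 0 = 0.
Proof. by rewrite /dot mulmx0 mxE. Qed.

Definition dotE := (dotD, dotN, dotZ, dot0).

Lemma dot_suml (J : finType) (A : {set J}) (F : J -> 'rV[R]_m) x :
  dot (\sum_(i in A) F i) x = \sum_(i in A) dot (F i) x.
Proof. by rewrite /dot mulmx_suml summxE. Qed.

(** The subspace of directions along which all forms of S are constant. Using
    kernels instead of spans of forms makes the dimension count below need no
    duality between vectors and forms. *)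
Definition dirs S : {vspace 'cV[R]_m} :=
  (\bigcap_(i in S) lker (linfun (mulmx (a i))))%VS.

Lemma dirsP S u : reflect (forall i, i \in S -> dot (a i) u = 0) (u \in dirs S).
Proof.
rewrite memvE; apply: (iffP subv_bigcapP) => h i iS; move: (h i iS).
  rewrite -memvE memv_ker lfunE /= => /eqP h0.
  by rewrite /dot h0 mxE.
move=> h0; rewrite -memvE memv_ker lfunE /=; apply/eqP/matrixP => r c.
by rewrite !ord1 [LHS]h0 mxE.
Qed.

Lemma dirsS S T : S \subset T -> (dirs T <= dirs S)%VS.
Proof.
move=> ST; apply/subvP => u /dirsP uT; apply/dirsP => i iS.
by apply: uT; apply: (subsetP ST).
Qed.

Lemma dirsU S T u : (u \in dirs (S :|: T)) = (u \in dirs S) && (u \in dirs T).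
Proof.
apply/idP/andP => [h|[/dirsP hS /dirsP hT]].
  by split; apply: (subvP (dirsS _)) h; rewrite ?subsetUl ?subsetUr.
by apply/dirsP => i; rewrite inE => /orP[/hS|/hT].
Qed.

Lemma dim_dirsU1 S i : (\dim (dirs S) <= (\dim (dirs (i |: S))).+1)%N.
Proof.
have -> : dirs (i |: S) = (dirs S :&: lker (linfun (mulmx (a i))))%VS.
  apply/vspaceP => u; rewrite memv_cap dirsU andbC; congr (_ && _).
  rewrite memv_ker lfunE /=; apply/dirsP/eqP => [/(_ i)|h j].
    rewrite inE eqxx => /(_ isT) h; apply/matrixP => r c.
    by rewrite !ord1 [LHS]h mxE.
  by rewrite inE => /eqP->; rewrite /dot h mxE.
rewrite -(limg_ker_dim (linfun (mulmx (a i))) (dirs S)) -[X in (_ <= X)%N]addn1.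
rewrite leq_add2l; apply: leq_trans (dimvS (subvf _)) _.
by rewrite dimvf /dim /= muln1.
Qed.

Lemma dim_dirsU S T : (\dim (dirs S) <= \dim (dirs (S :|: T)) + #|T|)%N.
Proof.
have [n] := ubnP #|T|; elim: n S T => // n IH S T; rewrite ltnS => Tn.
have [->|[i iT]] := set_0Vmem T; first by rewrite setU0 leq_addr.
have h : #|T| = (#|T :\ i|).+1 by rewrite (cardsD1 i) iT.
have /IH : (#|T :\ i| < n)%N by rewrite -h.
move=> /(_ (i |: S)); rewrite -setUA setUCA setD1K // => IH'.
by apply: leq_trans (dim_dirsU1 S i) _; rewrite h addnS ltnS.
Qed.

Lemma dim_dirsU1_eq S i u : u \in dirs S -> dot (a i) u != 0 ->
  (\dim (dirs (i |: S))).+1 = \dim (dirs S).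
Proof.
move=> uS ui; apply/eqP; rewrite eqn_leq dim_dirsU1 andbT.
have sub : (dirs (i |: S) <= dirs S)%VS by apply: dirsS; rewrite subsetUr.
rewrite ltn_neqAle dimvS // andbT (dimv_leqif_eq sub).
apply: contraNneq ui => eq; move: uS; rewrite -eq => /dirsP -> //.
by rewrite setU11.
Qed.

Definition feasible E I x : Prop :=
  (forall i, i \in E -> dot (a i) x = b i) /\
  (forall i, i \in I -> dot (a i) x <= b i).

Definition tight I x : {set 'I_k} := [set i in I | dot (a i) x == b i].

(** The algebraic form of a vertex. *)
Definition basic E I x : Prop :=
  feasible E I x /\ dirs (E :|: tight I x) = 0%VS.

(** The algebraic form of an edge: y - x spans the directions that keep all
    constraints tight at both ends. *)
Definition neighbours E I x y : Prop :=
  [/\ basic E I x, basic E I y, x != y &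
      (dirs (E :|: (tight I x :&: tight I y)) <= <[y - x]>)%VS].

Lemma tightP I x i : reflect (i \in I /\ dot (a i) x = b i) (i \in tight I x).
Proof. by rewrite inE; apply: (iffP andP) => -[? /eqP ?]. Qed.

Lemma feasible_dirs E I x y :
  feasible E I x -> feasible E I y -> y - x \in dirs E.
Proof.
move=> [xE _] [yE _]; apply/dirsP => i iE.
by rewrite dotB xE // yE // subrr.
Qed.

Lemma basic_inj E I x y :
  basic E I x -> basic E I y -> tight I x = tight I y -> x = y.
Proof.
move=> [fx x0] [fy _] eqT; apply/eqP; rewrite eq_sym -subr_eq0 -memv0 -x0.
rewrite dirsU (feasible_dirs fx fy) /=; apply/dirsP => i ix.
have /tightP[_ iy] : i \in tight I y by rewrite -eqT.
by move/tightP: ix => [_ ix]; rewrite dotB iy ix subrr.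
Qed.

Lemma neighbours_sym E I x y : neighbours E I x y -> neighbours E I y x.
Proof.
move=> [bx by_ xy h]; split=> //; first by rewrite eq_sym.
by rewrite setIC; apply: subv_trans h _; rewrite -memvE -opprB memvN memv_line.
Qed.

(** A pivot: S consists of tight constraints that, with E, cut out the line of u,
    so the ray leaves x along an edge, and the first constraint that it meets has a
    nonzero value on u and completes S to a set with trivial kernel. *)
Lemma step_along E I S x u : basic E I x -> u \in dirs E ->
  S \subset tight I x -> u \in dirs S -> (dirs (E :|: S) <= <[u]>)%VS ->
  (forall i, i \in tight I x -> dot (a i) u <= 0) ->
  (exists2 i, i \in I & 0 < dot (a i) u) ->
  exists (t : R) (i : 'I_k),
    [/\ 0 < t, 0 < dot (a i) u, i \in tight I (x + t *: u),
        feasible E I (x + t *: u) & neighbours E I x (x + t *: u)].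
Proof.
move=> bx uE ST uS line out [i0 i0I ui0]; have [[xE xI] x0] := bx.
case: (@first_hit R _ I (fun i => b i - dot (a i) x) (fun i => dot (a i) u)).
- by move=> i iI; rewrite subr_ge0 xI.
- by exists i0.
move=> t [i [t0 iI ui hit min]]; exists t, i.
have tgt0 : 0 < t.
  rewrite lt_neqAle t0 andbT eq_sym; apply: contraTneq ui => tz.
  rewrite -leNgt; apply: out; apply/tightP; split=> //.
  by apply/esym/eqP; rewrite -subr_eq0 hit tz mul0r.
have iT : i \in tight I (x + t *: u).
  by apply/tightP; split=> //; rewrite dotD dotZ -hit addrC subrK.
have fy : feasible E I (x + t *: u).
  split=> j jI; rewrite dotD dotZ.
    by rewrite (dirsP _ _ uE) // mulr0 addr0 xE.
  by rewrite -lerBrDl min.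
have SyS : S \subset tight I x :&: tight I (x + t *: u).
  rewrite subsetI ST /=; apply/subsetP => j jS; apply/tightP.
  have /tightP[jI jx] := subsetP ST j jS.
  by split=> //; rewrite dotD dotZ jx (dirsP _ _ uS) // mulr0 addr0.
have u0 : u != 0 by apply: contraTneq ui => ->; rewrite dot0 ltxx.
split=> //; split=> //; last 2 first.
- by rewrite eq_sym -subr_eq0 addrC addKr scaler_eq0 negb_or gt_eqF.
- apply: (subv_trans (dirsS (setUS E SyS))); apply: (subv_trans line).
  rewrite -memvE addrC addKr.
  by rewrite -[u in u \in _](scalerK (lt0r_neq0 tgt0)) memvZ ?memv_line.
split=> //; apply/eqP; rewrite -subv0; apply/subvP => z zd.
have /(subvP line)/vlineP[c zc] : z \in dirs (E :|: S).
  apply: (subvP (dirsS _)) zd; apply: setUS; apply: subset_trans SyS _.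
  exact: subsetIr.
have := dirsP _ _ zd i; rewrite inE iT orbT => /(_ isT).
rewrite zc dotZ => /eqP; rewrite mulf_eq0 (gt_eqF ui) orbF => /eqP->.
by rewrite scale0r mem0v.
Qed.

(** In a pointed cone, among the directions on which g is positive, one with the
    largest number of tight constraints spans an extreme ray. Otherwise another
    direction has the same tight constraints; corrected by a multiple of u0
    it has g = 0, and moving u0 along it makes a further constraint tight
    while g keeps its value. *)
Lemma extreme_direction E T g u0 : dirs (E :|: T) = 0%VS ->
  u0 \in dirs E -> (forall i, i \in T -> dot (a i) u0 <= 0) -> 0 < dot g u0 ->
  exists u, [/\ u \in dirs E, forall i, i \in T -> dot (a i) u <= 0,
    0 < dot g u & (dirs (E :|: [set i in T | dot (a i) u == 0%R]) <= <[u]>)%VS].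
Proof.
move=> ET0.
have [n] := ubnP #|[set i in T | dot (a i) u0 != 0]|.
elim: n u0 => // n IH u0; rewrite ltnS => un u0E u0T gu0.
set Z := [set i in T | dot (a i) u0 == 0].
have [|/subvPn[u2 u2Z u2l]] := boolP (dirs (E :|: Z) <= <[u0]>)%VS.
  by exists u0.
pose u3 := u2 - (dot g u2 / dot g u0) *: u0.
have gu3 : dot g u3 = 0 by rewrite dotB dotZ divfK ?subrr // gt_eqF.
have u0Z : u0 \in dirs (E :|: Z).
  by rewrite dirsU u0E /=; apply/dirsP => i; rewrite inE => /andP[_ /eqP].
have u3Z : u3 \in dirs (E :|: Z) by rewrite rpredB // rpredZ.
have u3n0 : u3 != 0.
  apply: contraNneq u2l => /eqP; rewrite subr_eq0 => /eqP ->.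
  by rewrite rpredZ // memv_line.
have [u [uZ gu [i iT ui]]] : exists u, [/\ u \in dirs (E :|: Z), dot g u = 0 &
    exists2 i, i \in T & 0 < dot (a i) u].
  have [i iT ui] : exists2 i, i \in T & dot (a i) u3 != 0.
    apply/exists_inP; apply: contraNT u3n0; rewrite negb_exists_in.
    move=> /forall_inP h; rewrite -memv0 -ET0 dirsU.
    move: u3Z; rewrite dirsU => /andP[-> _] /=.
    by apply/dirsP => i /h; rewrite negbK => /eqP.
  move: ui; rewrite neq_lt => /orP[ui|ui]; last first.
    by exists u3; split=> //; exists i.
  exists (- u3); split; rewrite ?rpredN // ?dotN ?gu3 ?oppr0 //.
  by exists i; rewrite // dotN oppr_gt0.
have [||t [j [t0 jT uj hit min]]] :=
    @first_hit R _ T (fun i => - dot (a i) u0) (fun i => dot (a i) u).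
- by move=> l lT; rewrite oppr_ge0 u0T.
- by exists i.
apply: (IH (u0 + t *: u)).
- apply: leq_trans un; apply: proper_card; apply/properP; split.
    apply/subsetP => l; rewrite !inE => /andP[lT]; rewrite lT /=.
    apply: contra => lu0.
    rewrite dotD dotZ (eqP lu0) (dirsP _ _ uZ) ?mulr0 ?addr0 //.
    by rewrite !inE lT lu0 orbT.
  exists j; last by rewrite inE jT /= negbK dotD dotZ -hit subrr.
  rewrite inE jT /=; apply: contraTneq uj => ju0.
  by rewrite (dirsP _ _ uZ) ?ltxx // !inE jT ju0 eqxx orbT.
- by rewrite rpredD // rpredZ //; move: uZ; rewrite dirsU => /andP[].
- by move=> l lT; rewrite dotD dotZ addrC -lerBrDr sub0r min.
- by rewrite dotD dotZ gu mulr0 addr0.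
Qed.

(** A simplex step. The direction w - x lies in the cone of x and increases g,
    so an extreme direction increasing g exists. Since g is bounded on the
    feasible set, some inequality ends the ray in that direction. *)
Lemma improving_neighbour E I g x w : basic E I x -> feasible E I w ->
  (forall y, feasible E I y -> dot g y <= dot g w) -> dot g x < dot g w ->
  exists2 y, neighbours E I x y & dot g x < dot g y.
Proof.
move=> bx fw wmax xw; have [[xE xI] x0] := bx.
have [||u [uE uT gu line]] := @extreme_direction E (tight I x) g (w - x) x0
    (feasible_dirs (proj1 bx) fw).
- move=> i /tightP[iI ix]; rewrite dotB ix subr_le0.
  by case: fw => _; apply.
- by rewrite dotB subr_gt0.
have [up|noup] := pselect (exists2 i, i \in I & 0 < dot (a i) u).
  have [||t [i [t0 _ _ _ nb]]] := step_along bx uE _ _ line uT up.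
  + by apply/subsetP => i; rewrite inE => /andP[].
  + by apply/dirsP => i; rewrite inE => /andP[_ /eqP].
  by exists (x + t *: u) => //; rewrite dotD dotZ ltrDl mulr_gt0.
(* an unbounded ray exceeds the maximum of g from time t on *)
exfalso; pose t := (dot g w - dot g x) / dot g u + 1.
have t0 : 0 < t by rewrite ltr_wpDl // divr_ge0 ?ltW // subr_gt0.
have fy : feasible E I (x + t *: u).
  split=> i iS; rewrite dotD dotZ.
    by rewrite (dirsP _ _ uE) // mulr0 addr0 xE.
  apply: le_trans (xI i iS); rewrite gerDl pmulr_rle0 // leNgt.
  by apply/negP => ui; apply: noup; exists i.
have := wmax _ fy; rewrite dotD dotZ mulrDl mul1r divfK ?gt_eqF //; lra.
Qed.

(** A normal vector exposing w: every inequality tight at w is maximal there,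
    so their sum is maximal only where all of them are tight. *)
Definition exposing I w : 'rV[R]_m := \sum_(i in tight I w) a i.

Lemma exposing_le E I w y : feasible E I w -> feasible E I y ->
  dot (exposing I w) y <= dot (exposing I w) w.
Proof.
move=> fw [_ yI]; rewrite !dot_suml; apply: ler_sum => i /tightP[iI ->].
exact: yI.
Qed.

Lemma exposing_eq E I w y : basic E I w -> feasible E I y ->
  dot (exposing I w) y = dot (exposing I w) w -> y = w.
Proof.
move=> [fw w0] fy; have [_ yI] := fy => /esym/eqP.
rewrite -subr_eq0 !dot_suml -sumrB => /eqP sum0.
apply/eqP; rewrite -subr_eq0 -memv0 -w0 dirsU (feasible_dirs fw fy) /=.
apply/dirsP => i iw; have : dot (a i) w - dot (a i) y = 0.
  move: i iw; apply: (psumr_eq0P _ sum0) => j /tightP[jI ->].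
  by rewrite subr_ge0 yI.
by rewrite dotB => /eqP; rewrite subr_eq0 => /eqP ->; rewrite subrr.
Qed.

(** At most n edges rather than exactly n, so that balls grow with the radius. *)
Fixpoint walk E I n v w : Prop :=
  if n is n'.+1 then
    walk E I n' v w \/ exists2 x, walk E I n' v x & neighbours E I x w
  else v = w.

Lemma walk0 E I n v : walk E I n v v.
Proof. by elim: n => //= n IH; left. Qed.

Lemma walk_widen E I n p v w : (n <= p)%N -> walk E I n v w -> walk E I p v w.
Proof. by move=> /subnK <- nvw; elim: (p - n)%N => //= q IH; left. Qed.

Lemma walk_cat E I n p v w x :
  walk E I n v w -> walk E I p w x -> walk E I (p + n) v x.
Proof.
move=> vw; elim: p x => [x <- //|p IH x] /= [/IH|[y /IH vy yx]]; first by left.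
by right; exists y.
Qed.

Lemma walk_sym E I n v w : walk E I n v w -> walk E I n w v.
Proof.
elim: n w => [w ->//|n IH w] [/IH|[x /IH xv xw]]; first by left.
rewrite -addn1; apply: walk_cat xv; right.
by exists w => //; apply: neighbours_sym.
Qed.

Lemma walk_basic E I n v w : basic E I v -> walk E I n v w -> basic E I w.
Proof.
by move=> bv; elim: n w => [w <-//|n IH w] [/IH|[x _ []]].
Qed.

(** The simplex method with the objective exposing w. It terminates because a
    vertex is determined by its tight inequalities, so the collection of tight
    sets of vertices with a larger objective shrinks at every step. *)
Lemma connected E I v w :
  basic E I v -> basic E I w -> exists n, walk E I n v w.
Proof.
move=> bv bw; set g := exposing I w.
pose above x := [set S : {set 'I_k} |
  `[< exists z, [/\ basic E I z, tight I z = S & dot g x < dot g z] >]].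
have [n] := ubnP #|above v|; elim: n v bv => // n IH v bv; rewrite ltnS => vn.
have [->|/eqP vw] := eqVneq v w; first by exists 0%N.
have fw := proj1 bw.
have ltvw : dot g v < dot g w.
  rewrite lt_neqAle (exposing_le fw (proj1 bv)) andbT.
  by apply/eqP => /(exposing_eq bw (proj1 bv)).
have [y vy gvy] := improving_neighbour bv fw
  (fun y fy => exposing_le fw fy) ltvw.
have by_ : basic E I y by case: vy.
have [|p yw] := IH y by_.
  apply: leq_trans vn; apply: proper_card; apply/properP; split.
    apply/subsetP => S; rewrite !inE => /asboolP[z [bz zS yz]]; apply/asboolP.
    by exists z; split=> //; apply: lt_trans yz.
  exists (tight I y); first by rewrite inE; apply/asboolP; exists y.
  rewrite inE; apply/negP => /asboolP[z [bz /(basic_inj bz by_) -> ]].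
  by rewrite ltxx.
exists (p + 1)%N; apply: walk_cat yw; right; by exists v.
Qed.

(** The inequalities that are not constant on the affine space of E. Dropping
    the others changes nothing, and for those kept, turning one into an equation
    lowers the dimension. *)
Definition essential E I : {set 'I_k} :=
  [set i in I | `[< exists2 u, u \in dirs E & dot (a i) u != 0 >]].

Lemma dirs_essential E I S : S \subset I ->
  dirs (E :|: (S :&: essential E I)) = dirs (E :|: S).
Proof.
move=> SI; apply/vspaceP => u; rewrite !dirsU.
have [uE /=|//] := boolP (u \in dirs E).
apply/dirsP/dirsP => h i; last by rewrite inE => /andP[/h].
move=> iS; have iI := subsetP SI i iS.
have [ie|] := boolP (i \in essential E I); first by rewrite h // inE iS.
rewrite inE iI /= => /asboolPn ni; apply/eqP/negP => /negP ui.
by apply: ni; exists u.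
Qed.

Lemma feasible_essential E I v x : feasible E I v ->
  feasible E (essential E I) x <-> feasible E I x.
Proof.
move=> [vE vI]; split=> -[xE xI]; split=> // i iI; last first.
  by apply: xI; move: iI; rewrite inE => /andP[].
have [/xI//|] := boolP (i \in essential E I).
rewrite inE iI /= => /asboolPn ni; suff -> : dot (a i) x = dot (a i) v.
  exact: vI.
apply/eqP; rewrite -subr_eq0 -dotB; apply/negP => /negP ui.
apply: ni; exists (x - v) => //.
by apply/dirsP => j jE; rewrite dotB xE // vE // subrr.
Qed.

Lemma tight_essential E I x :
  tight (essential E I) x = tight I x :&: essential E I.
Proof.
by apply/setP => i; rewrite !inE; case: (i \in I); rewrite //= andbC.
Qed.

Lemma tight_sub I x : tight I x \subset I.
Proof. by apply/subsetP => i /tightP[]. Qed.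

Lemma basic_essential E I v x : feasible E I v ->
  basic E (essential E I) x <-> basic E I x.
Proof.
move=> fv; rewrite /basic tight_essential dirs_essential ?tight_sub //.
by split=> -[/(feasible_essential _ fv)].
Qed.

Lemma neighbours_essential E I v x y : feasible E I v ->
  neighbours E (essential E I) x y -> neighbours E I x y.
Proof.
move=> fv [/(basic_essential _ fv) bx /(basic_essential _ fv) by_ xy h].
split=> //; move: h; rewrite !tight_essential setIACA setIid dirs_essential //.
by apply: subset_trans (tight_sub I x); apply: subsetIl.
Qed.

Lemma walk_mono E I E' I' n v w :
  (forall x y, neighbours E I x y -> neighbours E' I' x y) ->
  walk E I n v w -> walk E' I' n v w.
Proof.
move=> h; elim: n w => //= n IH w [/IH|[x /IH vx /h xw]]; first by left.
by right; exists x.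
Qed.

(** Passing to the face where the inequality i is an equation keeps the set of
    all tight constraints, hence vertices and, below, edges. *)
Lemma basic_facet E I i x : i \in tight I x ->
  basic (i |: E) (I :\ i) x <-> basic E I x.
Proof.
move=> ix; have /tightP[iI ixb] := ix; rewrite /basic.
have -> : (i |: E) :|: tight (I :\ i) x = E :|: tight I x.
  apply/setP => j; rewrite !inE; case: eqP => //= ->.
  by rewrite iI ixb eqxx !orbT.
suff -> : feasible (i |: E) (I :\ i) x <-> feasible E I x by [].
split=> -[xE xI]; split=> j.
- by move=> jE; apply: xE; rewrite inE jE orbT.
- have [->|ji] := eqVneq j i; first by rewrite ixb.
  by move=> jI; apply: xI; rewrite !inE ji.
- by rewrite !inE => /orP[/eqP->|/xE].
- by rewrite !inE => /andP[_ /xI].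
Qed.

Lemma neighbours_facet E I i x y : i \in I ->
  neighbours (i |: E) (I :\ i) x y -> neighbours E I x y.
Proof.
move=> iI [bx by_ xy h].
have tz z : basic (i |: E) (I :\ i) z -> i \in tight I z.
  by move=> [[zE _] _]; apply/tightP; split=> //; apply: zE; rewrite setU11.
have [tx ty] := (tz x bx, tz y by_).
split=> //; [exact/(basic_facet _ tx)|exact/(basic_facet _ ty)|].
apply: subv_trans h; apply: dirsS; apply/subsetP => j.
rewrite !inE; have [->|_] //= := eqVneq j i.
by move: tx ty; rewrite !inE => -> ->; rewrite orbT.
Qed.

Definition reached E I n v : {set 'I_k} :=
  [set i in I | `[< exists2 x, walk E I n v x & i \in tight I x >]].

Lemma tight_reached E I n v x : walk E I n v x ->
  tight (reached E I n v) x = tight I x.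
Proof.
move=> vx; apply/setP => i; rewrite !inE -andbA; case iI: (i \in I) => //=.
case: eqP => [ix|]; rewrite ?andbF // andbT; apply/asboolP.
by exists x => //; apply/tightP.
Qed.

Lemma feasible_sub E I (J : {set 'I_k}) x : J \subset I ->
  feasible E I x -> feasible E J x.
Proof. by move=> JI [xE xI]; split=> // i iJ; apply/xI/(subsetP JI). Qed.

Lemma reached_sub E I n v : reached E I n v \subset I.
Proof. by apply/subsetP => i; rewrite inE => /andP[]. Qed.

Lemma basic_reached E I n v x : basic E I x -> walk E I n v x ->
  basic E (reached E I n v) x.
Proof.
move=> [fx x0] vx; rewrite /basic tight_reached //; split=> //.
exact: feasible_sub (reached_sub _ _ _ _) fx.
Qed.

(** An edge from x of the relaxed system whose other end w violates a dropped
    inequality would be cut at a vertex of the original system before w. This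
    vertex is still in the ball, so the inequality that cuts there has been
    recorded; but a recorded inequality holds at w. *)
Lemma walk_of_reached E I n p v w : basic E I v -> (p <= n)%N ->
  walk E (reached E I n v) p v w -> walk E I p v w.
Proof.
move=> bv; set J := reached E I n v.
elim: p w => // p IH w pn [vw|[x vx xw]]; first by left; apply: IH => //; lia.
have {}vx : walk E I p v x by apply: IH => //; lia.
right; exists x => //.
have bx := walk_basic bv vx.
have [_ bJw xnw line] := xw; have [fJw w0] := bJw.
have tx : tight J x = tight I x.
  by apply: tight_reached; apply: walk_widen vx; lia.
have JI : J \subset I := reached_sub _ _ _ _.
have tw : tight J w \subset tight I w.
  by apply/subsetP => i /tightP[iJ iw]; apply/tightP; rewrite (subsetP JI).
have [|nfw] := pselect (feasible E I w).
  move=> fw; split=> //.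
    split=> //; apply/eqP; rewrite -subv0 -w0.
    by apply: dirsS; rewrite setUS.
  by apply: subv_trans line; apply: dirsS; rewrite setUS // tx setIS.
exfalso.
have [i iI iw] : exists2 i, i \in I & b i < dot (a i) w.
  apply: contrapT => h; apply: nfw; split; first by case: fJw.
  move=> i iI; rewrite leNgt; apply/negP => iw; apply: h; by exists i.
have [[xE xI] x0] := bx.
have [|||||t [j [t0 ju jy _ nb]]] :=
  @step_along E I (tight J x :&: tight J w) x (w - x) bx _ _ _ line.
- by apply: (feasible_dirs _ fJw); apply: feasible_sub JI _; case: bx.
- by rewrite tx subsetIl.
- apply/dirsP => j; rewrite inE => /andP[/tightP[_ jx] /tightP[_ jw]].
  by rewrite dotB jx jw subrr.
- move=> j; rewrite -tx => /tightP[jJ jx]; rewrite dotB jx subr_le0.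
  by case: fJw => _; apply.
- by exists i => //; rewrite dotB subr_gt0; apply: le_lt_trans iw; apply: xI.
have vy : walk E I n v (x + t *: (w - x)).
  by apply: (@walk_widen _ _ p.+1) => //; right; exists x.
have jJ : j \in J.
  rewrite inE; have /tightP[-> _] := jy; apply/asboolP.
  by exists (x + t *: (w - x)).
have [[yE yI] _] := walk_basic bv vy.
have jw : dot (a j) w <= b j by case: fJw => _; apply.
move/tightP: jy => [_]; rewrite !dotE => jy.
have := yI i iI; rewrite !dotE => iy.
have ix := xI i iI; move: ju; rewrite dotB => ju.
(* j is hit no earlier than w, whereas i is already violated at w *)
have t1 : 1 <= t.
  by rewrite -(ler_pM2r ju) mul1r -(lerD2l (dot (a j) x)) jy addrC subrK.
have iwx : 0 <= dot (a i) w - dot (a i) x.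
  by rewrite subr_ge0 ltW // (le_lt_trans ix).
have := ler_wpM2r iwx t1; rewrite mul1r => iw1.
by clear -iy iw iw1; lra.
Qed.

(** If the relaxed system has radius n around v, then no vertex is at distance
    exactly n + 1 from v in the original graph, and connectedness puts every
    vertex within distance n. *)
Lemma walk_or_reached E I n v w : basic E I v -> basic E I w ->
  (forall x, basic E (reached E I n.+1 v) x ->
     walk E (reached E I n.+1 v) n v x) ->
  walk E I n v w.
Proof.
move=> bv bw h; have [p] := connected bv bw.
elim: p w bw => [w bw <-|p IH w bw [/IH|]]; first exact: walk0.
  exact.
move=> [x vx xw]; have bx := walk_basic bv vx.
have vw : walk E I n.+1 v w by right; exists x => //; apply: IH.
apply: (@walk_of_reached E I n.+1) => //; apply: h.
exact: basic_reached.
Qed.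
End System.

(** * The Kalai-Kleitman recursion *)

(** The recursion unrolled over the dimension, for fewer than 2^s inequalities,
    so that halving their number lowers s by one. Each step from dimension i - 1
    to i costs twice the bound for half as many inequalities plus two edges,
    taken here in dimension d for all i; only the dimensions i <= 2^(s - 1)
    contribute, since in larger ones two vertices always share a facet. *)
Fixpoint kalai_kleitman s d : nat :=
  if s is s'.+1 then (minn d (2 ^ s') * (2 * kalai_kleitman s' d + 2))%N
  else 0%N.

Lemma kalai_kleitman_mono s d e : (d <= e)%N ->
  (kalai_kleitman s d <= kalai_kleitman s e)%N.
Proof.
move=> de; elim: s => //= s IH.
by rewrite leq_mul // ?leq_add2r ?leq_mul2l ?IH ?orbT //; lia.
Qed.

Section KalaiKleitman.
Import mathcomp.boot.fintype mathcomp.boot.finset.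
Variables (R : realFieldType) (m k : nat).
Variables (a : 'I_k -> 'rV[R]_m) (b : 'I_k -> R).
Implicit Types (E I S T : {set 'I_k}) (v w : 'cV[R]_m).

Lemma overlap (S T I : {set 'I_k}) : S \subset I -> T \subset I ->
  (#|I| < #|S| + #|T|)%N -> exists i, i \in S :&: T.
Proof.
move=> SI TI lt; have [ST0|[i iST]] := set_0Vmem (S :&: T); last by exists i.
have := subset_leq_card (introT subUsetP (conj SI TI)).
by rewrite cardsU ST0 cards0 subn0 leqNgt lt.
Qed.

(** Each inequality cuts the dimension by at most one, and at a basic solution
    the tight ones cut it to zero. *)
Lemma dim_le_tight E I v :
  basic a b E I v -> (\dim (dirs a E) <= #|tight a b I v|)%N.
Proof.
by move=> [_ v0]; have := dim_dirsU a E (tight a b I v); rewrite v0 dimv0.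
Qed.

(** Induction on s and, for fixed s, on the dimension: the relaxed systems defined
    by few recorded inequalities have a smaller s, the facets a smaller
    dimension. *)
Lemma walk_bound s d E I v w : \dim (dirs a E) = d -> (#|I| < 2 ^ s)%N ->
  basic a b E I v -> basic a b E I w -> walk a b E I (kalai_kleitman s d) v w.
Proof.
(* in dimension 0 there is at most one feasible point *)
have trivial E' I' x y : \dim (dirs a E') = 0%N -> basic a b E' I' x ->
    basic a b E' I' y -> x = y.
  move=> /eqP; rewrite dimv_eq0 => /eqP E0 [fx _] [fy _]; apply/eqP.
  by rewrite eq_sym -subr_eq0 -memv0 -E0; apply: feasible_dirs fx fy.
elim: s d E I v w => [|s IHs] d E I v w.
  rewrite expn0 ltnS leqn0 cards_eq0 => dE /eqP -> bv bw.
  apply: walk_widen (leq0n _) _ => /=; apply: (trivial _ _ _ _ _ bv bw).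
  apply/eqP; rewrite -leqn0; apply: leq_trans (dim_le_tight bv) _.
  by rewrite -(cards0 'I_k) subset_leq_card // tight_sub.
elim: d E I v w => [|d IHd] E I v w dE cI bv bw.
  by apply: walk_widen (leq0n _) _ => /=; apply: (trivial _ _ _ _ _ bv bw).
have fv := proj1 bv.
apply: (walk_mono (fun x y => neighbours_essential fv)).
move/(basic_essential _ fv) : bv => bv.
move/(basic_essential _ fv) : bw => bw.
have {}cI : (#|essential a E I| < 2 ^ s.+1)%N.
  apply: leq_ltn_trans cI; apply: subset_leq_card.
  by apply/subsetP => i; rewrite inE => /andP[].
have ess i : i \in essential a E I ->
    exists2 u, u \in dirs a E & dot (a i) u != 0.
  by rewrite inE => /andP[_ /asboolP].
move: (essential a E I) ess cI bv bw => {fv} J ess cI bv bw.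
have facet_walk i x y : basic a b E J x -> basic a b E J y ->
    i \in tight a b J x :&: tight a b J y ->
    walk a b E J (kalai_kleitman s.+1 d) x y.
  move=> bx by_; rewrite inE => /andP[ix iy]; have /tightP[iJ _] := ix.
  apply: (walk_mono (fun z z' => neighbours_facet iJ)).
  apply: IHd; [|exact: leq_ltn_trans (subset_leq_card (subD1set _ _)) cI
    |exact/(basic_facet _ ix)|exact/(basic_facet _ iy)].
  apply/eqP; rewrite -eqSS -dE; have [u uE ui] := ess i iJ.
  by rewrite (dim_dirsU1_eq uE).
(* in high dimension more than half of the inequalities are tight at each of
   v and w *)
have [ds|sd] := leqP d.+1 (2 ^ s); last first.
  apply: (walk_widen (kalai_kleitman_mono _ (leqnSn d))).
  have [|||i iT] := @overlap (tight a b J v) (tight a b J w) J.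
  - exact: tight_sub.
  - exact: tight_sub.
  - apply: leq_trans cI _; rewrite expnS mul2n -addnn.
    by apply: leq_add; (apply: leq_trans (dim_le_tight _); [|eassumption]);
      rewrite dE ltnW.
  exact: facet_walk iT.
set D := kalai_kleitman s d.+1.
have step : (kalai_kleitman s.+1 d + (2 * D + 2) <= kalai_kleitman s.+1 d.+1)%N.
  rewrite /= -/D (minn_idPl ds) (minn_idPl (ltnW ds)) (mulSnr d) leq_add2r.
  by rewrite leq_mul2l leq_add2r leq_mul2l kalai_kleitman_mono ?orbT.
have near x y : basic a b E J x -> basic a b E J y ->
    walk a b E J D x y \/ (2 ^ s <= #|reached a b E J D.+1 x|)%N.
  move=> bx by_; have [|lt] := leqP (2 ^ s) #|reached a b E J D.+1 x|.
    by right.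
  left; apply: walk_or_reached => // z bz; apply: IHs => //.
  by apply: basic_reached => //; apply: walk0.
have [vw|Rv] := near v w bv bw; first by apply: walk_widen vw; lia.
have [wv|Rw] := near w v bw bv.
  by apply: walk_widen (walk_sym wv); lia.
have [|||i] := @overlap (reached a b E J D.+1 v) (reached a b E J D.+1 w) J.
- exact: reached_sub.
- exact: reached_sub.
- by apply: leq_trans cI _; rewrite expnS mul2n -addnn leq_add.
rewrite !inE => /andP[/andP[_ /asboolP[x vx ix]] /andP[_ /asboolP[y wy iy]]].
apply: (@walk_widen _ _ _ _ _ _ _ (D.+1 + (kalai_kleitman s.+1 d + D.+1))).
  by move: step; lia.
apply: walk_cat (walk_sym wy); apply: (walk_cat vx).
apply: (@facet_walk i); [exact: walk_basic vx|exact: walk_basic wy|].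
by rewrite inE ix.
Qed.
End KalaiKleitman.

(** * From polyhedra to systems *)

Section Geometry.
Import mathcomp.boot.fintype mathcomp.boot.finset.
Variables (R : realType) (m k : nat).
Variables (a : 'I_k -> 'rV[R]_m) (b : 'I_k -> R).
Implicit Types (E I : {set 'I_k}) (v w x y u : 'cV[R]_m).

Definition solutions E I : set 'cV[R]_m := [set x | feasible a b E I x]%classic.

(** Small moves in both directions along u: tight constraints do not change
    their value and the others have some slack. *)
Lemma feasible_wiggle E I x u : feasible a b E I x ->
  u \in dirs a (E :|: tight a b I x) ->
  exists2 e : R, 0 < e & forall t, `|t| <= e -> feasible a b E I (x + t *: u).
Proof.
move=> [xE xI]; rewrite dirsU => /andP[/dirsP uE /dirsP uT].
suff [e e0 he] : exists2 e : R, 0 < e & forall t i, `|t| <= e -> i \in I ->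
    t * dot (a i) u <= b i - dot (a i) x.
  exists e => // t te; split=> i iS; rewrite dotD dotZ.
    by rewrite uE // mulr0 addr0 xE.
  by rewrite -lerBrDl he.
have [[i0 i0I ui0]|no] := pselect (exists2 i, i \in I & 0 < `|dot (a i) u|);
  last first.
  exists 1 => // t i _ iI; have /eqP -> : dot (a i) u == 0.
    by apply: contrapT => /negP ui; apply: no; exists i; rewrite ?normr_gt0.
  by rewrite mulr0 subr_ge0 xI.
have [||e [i [e0 iI ui hit min]]] := @first_hit R _ (I :\: tight a b I x)
  (fun i => b i - dot (a i) x) (fun i => `|dot (a i) u|).
- by move=> i; rewrite inE => /andP[_ iI]; rewrite subr_ge0 xI.
- exists i0 => //; rewrite inE i0I andbT; apply: contraTN ui0 => /uT ->.
  by rewrite normr0 ltxx.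
move: iI; rewrite inE => /andP[iT iI].
exists e => [|t j te jI].
  rewrite lt_neqAle e0 andbT eq_sym; apply: contraNneq iT => ez.
  apply/tightP; split=> //; apply/esym/eqP.
  by rewrite -subr_eq0 hit ez mul0r.
have [jT|jT] := boolP (j \in tight a b I x).
  by rewrite uT // mulr0 subr_ge0 xI.
apply: le_trans (min j _); last by rewrite inE jT.
by rewrite (le_trans (ler_norm _)) // normrM ler_wpM2r.
Qed.

(** Moving both ways along a direction that keeps the tight constraints tight
    stays in the polyhedron, hence in the exposed face, which is a point. *)
Lemma vertex_basic E I v : vertex (solutions E I) v -> basic a b E I v.
Proof.
move=> [g [c [Pc vE]]]; have : (solutions E I `&` hyperplane g c)%classic v.
  by rewrite -vE.
move=> [/= fv gv]; split=> //; apply/eqP; rewrite -subv0; apply/subvP => u ud.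
have [e e0 he] := feasible_wiggle fv ud.
have gv' : dot g v = c := gv.
have gu : dot g u = 0.
  have fp : feasible a b E I (v + e *: u) by apply: he; rewrite gtr0_norm.
  have fm : feasible a b E I (v + (- e) *: u).
    by apply: he; rewrite normrN gtr0_norm.
  have := Pc _ fp; have := Pc _ fm.
  rewrite /halfspace /= -!/(dot _ _) !dotD !dotZ gv'; nra.
have : (solutions E I `&` hyperplane g c)%classic (v + e *: u).
  split=> /=; first by apply: he; rewrite gtr0_norm ?lexx.
  by rewrite /hyperplane /= -/(dot _ _) dotD dotZ gu mulr0 addr0.
rewrite -vE /= => /eqP; rewrite -subr_eq0 addrC addKr scaler_eq0.
by rewrite gt_eqF //= memv0.
Qed.

Lemma basic_vertex E I v : basic a b E I v -> vertex (solutions E I) v.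
Proof.
move=> bv; exists (exposing a b I v), (dot (exposing a b I v) v); split.
  by move=> x /= fx; apply: exposing_le fx; case: bv.
apply/seteqP; split=> x /= => [->|[fx eqx]]; last exact: (exposing_eq bv fx eqx).
by split=> //; case: bv.
Qed.

Lemma affine_dim_unique (S : set 'cV[R]_m) p q :
  affine_dim S p -> affine_dim S q -> p = q.
Proof.
move=> [x [V [Sx <- SV minV]]] [y [W [Sy <- SW minW]]].
apply/eqP; rewrite eqn_leq; apply/andP; split; apply: dimvS.
  apply: minV => z Sz; have -> : z - x = (z - y) - (x - y).
    by rewrite opprB addrA subrK.
  by rewrite rpredB ?SW.
apply: minW => z Sz; have -> : z - y = (z - x) - (y - x).
  by rewrite opprB addrA subrK.
by rewrite rpredB ?SV.
Qed.

(** Around a point where no inequality is tight, the polyhedron fills the affine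
    space of E. *)
Lemma affine_dim_solutions E I x : feasible a b E I x -> tight a b I x = set0 ->
  affine_dim (solutions E I) (\dim (dirs a E)).
Proof.
move=> fx x0; exists x, (dirs a E); split=> // [y fy|W hW].
  exact: feasible_dirs fx fy.
apply/subvP => u uE; have [|e e0 he] := @feasible_wiggle E I x u fx.
  by rewrite x0 setU0.
have := hW (x + e *: u); rewrite /solutions /= => /(_ (he e _)).
rewrite gtr0_norm // => /(_ (lexx _)).
by rewrite addrC addKr => /(memvZ e^-1); rewrite scalerK ?gt_eqF.
Qed.

(** The common tight inequalities expose the part of the line through v and w
    that lies in the polyhedron. At each end some tight inequality varies along
    this line, so the line leaves the polyhedron there and the exposed face is
    the segment. *)
Lemma neighbours_adjacent E I v w :
  neighbours a b E I v w -> Defs.adjacent (solutions E I) v w.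
Proof.
move=> [bv bw vw line]; have [fv v0] := bv; have [fw w0] := bw.
split; [exact: basic_vertex|exact: basic_vertex|split]; last first.
  exists v, <[w - v]>%VS; split.
  - by exists 0; rewrite /= ?in_itv /= ?lexx ?ler01 // subr0 scale1r scale0r addr0.
  - by rewrite dim_vline subr_eq0 eq_sym vw.
  - move=> _ [t _ <-]; have -> : (1 - t) *: v + t *: w - v = t *: (w - v).
      by rewrite scalerBl scale1r scalerBr addrAC [v - _]addrC addrK addrC.
    by rewrite memvZ ?memv_line.
  - move=> W hW; rewrite -memvE; apply: hW.
    by exists 1; rewrite /= ?in_itv /= ?lexx ?ler01 // subrr scale1r scale0r add0r.
set T := tight a b I v :&: tight a b I w.
exists (\sum_(i in T) a i), (\sum_(i in T) b i); split.
  move=> x [_ xI] /=; rewrite /halfspace /= -/(dot _ _) dot_suml.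
  by apply: ler_sum => i; rewrite inE => /andP[/tightP[iI _] _]; apply: xI.
apply/seteqP; split=> [_ [t /= /itvP t01 <-]|x [fx]].
  have t0 : 0 <= t by rewrite t01.
  have t1 : 0 <= 1 - t by rewrite subr_ge0 t01.
  have [[vE vI] [wE wI]] := (fv, fw).
  split; first split=> i iS; rewrite ?dotD ?dotZ.
  - by rewrite vE // wE // -mulrDl subrK mul1r.
  - have := vI i iS; have := wI i iS; nra.
  rewrite /hyperplane /= -/(dot _ _) dot_suml; apply: eq_bigr => i.
  rewrite inE => /andP[/tightP[_ iv] /tightP[_ iw]].
  by rewrite dotD !dotZ iv iw -mulrDl subrK mul1r.
rewrite /hyperplane /= -/(dot _ _) dot_suml => /esym/eqP.
rewrite -subr_eq0 -sumrB => /eqP sum0.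
have xT i : i \in T -> dot (a i) x = b i.
  move=> iT; apply/esym/eqP; rewrite -subr_eq0; apply/eqP; move: i iT.
  apply: (psumr_eq0P _ sum0) => j; rewrite inE => /andP[/tightP[jI _] _].
  by rewrite subr_ge0; case: fx => _; apply.
have [t xt] : exists t, x - v = t *: (w - v).
  apply/vlineP; apply: (subvP line); rewrite dirsU (feasible_dirs fv fx) /=.
  apply/dirsP => i iT; rewrite dotB xT //; move: iT; rewrite inE.
  by move=> /andP[/tightP[_ ->] _]; rewrite subrr.
have [xE xI] := fx; have [vE vI] := fv; have [wE wI] := fw.
(* a basic solution blocks the line through it on at least one side *)
have blocked y u : basic a b E I y -> u != 0 -> u \in dirs a E ->
    exists2 i, i \in I & dot (a i) y = b i /\ dot (a i) u != 0.
  move=> [_ y0] u0 uE; apply: contrapT => no; move/negP: u0; apply.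
  rewrite -memv0 -y0 dirsU uE /=; apply/dirsP => i /tightP[iI iy].
  by apply: contrapT => /eqP iu; apply: no; exists i.
have wvE : w - v \in dirs a E := feasible_dirs fv fw.
have wv0 : w - v != 0 by rewrite subr_eq0 eq_sym.
have xE' : x = v + t *: (w - v) by rewrite -xt addrC subrK.
exists t; last by rewrite xE' scalerBl scale1r scalerBr addrAC addrA.
have [i iI [iv iu]] := blocked v _ bv wv0 wvE.
have [j jI [jw ju]] := blocked w _ bw wv0 wvE.
rewrite /= in_itv /=; apply/andP; split.
  have := xI i iI; have := wI i iI; move: iu.
  rewrite xE' !dotE iv neq_lt => /orP[]; nra.
have := xI j jI; have := vI j jI; move: ju.
rewrite xE' !dotE jw neq_lt => /orP[]; nra.
Qed.

Lemma walk_path E I n v w : walk a b E I n v w ->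
  exists p, [/\ path (fun x y => `[< Defs.adjacent (solutions E I) x y >]) v p,
                last v p = w & (size p <= n)%N].
Proof.
elim: n w => [w <-|n IH w] /=; first by exists [::].
move=> [/IH[p [vp pw pn]]|[x /IH[p [vp px pn]] xw]].
  by exists p; split=> //; apply: leqW.
exists (rcons p w); split; last by rewrite size_rcons.
  rewrite rcons_path vp px /=; apply/asboolP; exact: neighbours_adjacent.
by rewrite last_rcons.
Qed.

Lemma diameter_solutions E I s : (#|I| < 2 ^ s)%N ->
  (diameter (solutions E I) <= (kalai_kleitman s (\dim (dirs a E)))%:R%:E)%E.
Proof.
move=> Is; apply: ge_ereal_sup => _ [v /vertex_basic bv [w /vertex_basic bw <-]].
have [p [vp pw pn]] := walk_path (walk_bound erefl Is bv bw).
apply: (@le_trans _ _ (size p)%:R%:E); last by rewrite lee_fin ler_nat.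
by apply: ereal_inf_lbound; exists p.
Qed.

(** On the way from x0 to a point that violates only the inequality i, there is
    a point where i is tight and no other inequality is. *)
Lemma crossing_point E I x0 i : feasible a b E I x0 -> tight a b I x0 = set0 ->
  i \in I -> (exists z, feasible a b E (I :\ i) z /\ ~ feasible a b E I z) ->
  exists2 y, feasible a b E I y & tight a b I y = [set i].
Proof.
move=> [xE xI] T0 iI [z [[zE zI] nz]].
have xlt j : j \in I -> dot (a j) x0 < b j.
  move=> jI; rewrite lt_neqAle xI // andbT; apply/eqP => jx.
  by have /tightP : j \in I /\ dot (a j) x0 = b j by []; rewrite T0 inE.
have zi : b i < dot (a i) z.
  rewrite ltNge; apply/negP => zi; apply: nz; split=> // j jI.
  by have [->//|ji] := eqVneq j i; apply: zI; rewrite !inE ji.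
have xi := xlt i iI.
pose t := (b i - dot (a i) x0) / (dot (a i) z - dot (a i) x0).
have den : 0 < dot (a i) z - dot (a i) x0 by rewrite subr_gt0 (lt_trans xi).
have t0 : 0 < t by rewrite divr_gt0 // subr_gt0.
have t1 : t < 1 by rewrite ltr_pdivrMr // mul1r ltrD2r.
have yi : dot (a i) (x0 + t *: (z - x0)) = b i.
  by rewrite dotD dotZ dotB divfK ?gt_eqF // addrC subrK.
have ylt j : j \in I -> j != i -> dot (a j) (x0 + t *: (z - x0)) < b j.
  move=> jI ji; rewrite dotD dotZ dotB.
  have := xlt j jI; have : dot (a j) z <= b j by apply: zI; rewrite !inE ji.
  nra.
exists (x0 + t *: (z - x0)).
  split=> j jS; first by rewrite dotD dotZ dotB xE // zE // subrr mulr0 addr0.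
  by have [->|ji] := eqVneq j i; [rewrite yi|apply/ltW/ylt].
apply/setP => j; apply/tightP/set1P => [[jI jy]|->//].
by apply/eqP; apply: contraT => /(ylt j jI); rewrite jy ltxx.
Qed.

(** Around y the facet fills the affine space where i is an equation as well,
    and this space has one dimension less because i is slack at x0. *)
Lemma facet_solutions E I x0 y i : feasible a b E I x0 ->
  tight a b I x0 = set0 -> feasible a b E I y -> tight a b I y = [set i] ->
  facet (solutions E I) (solutions E I `&` hyperplane (a i) (b i))%classic.
Proof.
move=> fx0 T0 fy yT; have iy : i \in tight a b I y by rewrite yT set11.
have [iI yi] := tightP _ _ _ _ _ iy; split.
  exists (a i), (b i); split=> // x [_ xI]; exact: xI.
exists (\dim (dirs a (i |: E))).
have -> : (\dim (dirs a (i |: E))).+1 = \dim (dirs a E).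
  apply: (dim_dirsU1_eq (feasible_dirs fx0 fy)).
  rewrite dotB yi subr_eq0; apply/eqP => bx.
  by have /tightP : i \in I /\ dot (a i) x0 = b i by []; rewrite T0 inE.
split; first exact: affine_dim_solutions T0.
have -> : (solutions E I `&` hyperplane (a i) (b i))%classic =
    solutions (i |: E) (I :\ i).
  apply/seteqP; split=> x /=.
    move=> [[xE xI] xi]; split=> j; rewrite !inE.
      by move=> /orP[/eqP->//|/xE].
    by move=> /andP[_ /xI].
  move=> [xE xI]; have xi : dot (a i) x = b i by apply: xE; rewrite setU11.
  split=> //; split=> j jS; first by apply: xE; rewrite inE jS orbT.
  by have [->|ji] := eqVneq j i; [rewrite xi|apply: xI; rewrite !inE ji].
have [yE yI] := fy; apply: (@affine_dim_solutions _ _ y).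
  split=> j; rewrite !inE; first by move=> /orP[/eqP->|/yE].
  by move=> /andP[_ /yI].
apply/setP => j; rewrite [RHS]inE; apply/negP => /tightP[].
rewrite !inE => /andP[ji jI] jy.
have /tightP : j \in I /\ dot (a j) y = b j by [].
by rewrite yT inE (negPf ji).
Qed.

(** The crossing point of i lies on the facet of i and on no other facet, so
    distinct inequalities define distinct facets. *)
Lemma card_irredundant E I x0 n : feasible a b E I x0 -> tight a b I x0 = set0 ->
  (forall i, i \in I ->
     exists z, feasible a b E (I :\ i) z /\ ~ feasible a b E I z) ->
  ([set F | facet (solutions E I) F]%classic #= `I_n)%card -> (#|I| <= n)%N.
Proof.
move=> fx0 T0 irr cardF; have [->|[i0 i0I]] := set_0Vmem I; first by rewrite cards0.
pose F i := (solutions E I `&` hyperplane (a i) (b i))%classic.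
have Finj i j : i \in I -> j \in I -> F i = F j -> i = j.
  move=> iI jI Fij; have [y fy yT] := crossing_point fx0 T0 iI (irr i iI).
  have /tightP[_ yi] : i \in tight a b I y by rewrite yT set11.
  have [_ yj] : F j y by rewrite -Fij.
  have /tightP : j \in I /\ dot (a j) y = b j by [].
  by rewrite yT inE => /eqP.
have nthI j : (j < #|I|)%N -> nth i0 (enum I) j \in I.
  by rewrite cardE => jI; rewrite -mem_enum mem_nth.
rewrite -card_le_II; rewrite -(card_le_eqr cardF).
have inj : {in `I_#|I|%classic &, injective (fun j => F (nth i0 (enum I) j))}.
  move=> p q; rewrite !in_setE /= => pI qI /Finj.
  rewrite !nthI // => /(_ isT isT) /eqP.
  by rewrite nth_uniq ?enum_uniq -?cardE // => /eqP.
rewrite -(card_le_eql (inj_card_eq inj)); apply: subset_card_le.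
move=> _ [j /= jI <-]; have iI := nthI j jI.
have [y fy yT] := crossing_point fx0 T0 iI (irr _ iI).
exact: facet_solutions fx0 T0 fy yT.
Qed.

End Geometry.

(** E collects the inequalities that hold with equality on all of P, and I is a
    smallest set of inequalities that together with E describes P. *)
Lemma facet_presentation (R : realType) (m d n : nat) (P : set 'cV[R]_m) :
  polyhedron P -> affine_dim P d -> ([set F | facet P F]%classic #= `I_n)%card ->
  exists k (a : 'I_k -> 'rV[R]_m) (b : 'I_k -> R) (E I : {set 'I_k}),
    [/\ P = solutions a b E I, \dim (dirs a E) = d & (#|I| <= n)%N].
Proof.
move=> [k [a [b [_ Pdef]]]] Pd cardF.
have PE x : P x <-> forall i, dot (a i) x <= b i.
  rewrite Pdef; split=> [h i|h i _]; last exact: h.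
  exact: (h i I).
pose E := ([set i | `[< forall x, P x -> dot (a i) x = b i >]])%SET.
have EP i x : i \in E -> P x -> dot (a i) x = b i.
  by rewrite inE => /asboolP; apply.
have full : P = solutions a b E (~: E)%SET.
  apply/seteqP; split=> x /=.
    by move=> Px; split=> i; [move/EP; apply|move=> _; apply: (proj1 (PE x) Px)].
  move=> [xE xI]; apply/PE => i; have [iE|iE] := boolP (i \in E).
    by rewrite xE.
  by apply: xI; rewrite finset.in_setC.
have [x0 Px0 x0T] : exists2 x, P x & tight a b (~: E)%SET x = finset.set0.
  have [x Px] : exists x, P x by case: Pd => x [V [Px _ _ _]]; exists x.
  (* a point of P with fewest tight inequalities outside E has none: if
     i is tight, moving halfway to a point where i is slack frees i and tightens nothing *)
  have [p] := ubnP #|tight a b (~: E)%SET x|.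
  elim: p x Px => // p IH x Px; rewrite ltnS => xp.
  have [T0|[i iT]] := set_0Vmem (tight a b (~: E)%SET x); first by exists x.
  have /tightP[iE ix] := iT.
  have [y Py iy] : exists2 y, P y & dot (a i) y < b i.
    move: iE; rewrite finset.in_setC inE => /asboolPn/existsNP[y /not_implyP[Py iy]].
    exists y => //; rewrite lt_neqAle; apply/andP; split; first exact/eqP.
    exact: (proj1 (PE y) Py).
  have [Px' Py'] := (proj1 (PE x) Px, proj1 (PE y) Py).
  apply: (IH (2^-1 *: x + 2^-1 *: y)).
    apply/PE => j; rewrite dotD !dotZ; have := Px' j; have := Py' j; lra.
  apply: leq_trans xp; apply: proper_card; apply/properP; split.
    apply/fintype.subsetP => j /tightP[jE]; rewrite dotD !dotZ => jx.
    apply/tightP; split=> //; have := Px' j; have := Py' j; lra.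
  exists i => //; apply/negP => /tightP[_]; rewrite dotD !dotZ ix; lra.
have exI : exists q, `[< exists I : {set 'I_k},
    [/\ P = solutions a b E I, I \subset (~: E)%SET & #|I| = q] >].
  by exists #|(~: E)%SET|; apply/asboolP; exists (~: E)%SET.
case: (ex_minnP exI) => q /asboolP[I [PI IE Iq]] qmin {exI}.
have fx0 : feasible a b E I x0 by move: Px0; rewrite PI.
have x0I : tight a b I x0 = finset.set0.
  apply/eqP; rewrite -finset.subset0 -x0T; apply/fintype.subsetP => i.
  by move=> /tightP[/(fintype.subsetP IE) iE ix]; apply/tightP.
exists k, a, b, E, I; split=> //.
  by apply: affine_dim_unique Pd; rewrite PI; apply: affine_dim_solutions x0I.
apply: (card_irredundant fx0 x0I) => [i iI|]; last by rewrite -PI.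
apply: contrapT => no; have : (q <= #|I :\ i|)%N.
  apply: qmin; apply/asboolP; exists (I :\ i); split=> //.
    rewrite PI; apply/seteqP; split=> z /= fz.
      exact: feasible_sub (subD1set _ _) fz.
    by apply: contrapT => nz; apply: no; exists z.
  by apply: fintype.subset_trans IE; apply: subD1set.
by rewrite -Iq (cardsD1 i) iI ltnn.
Qed.

Lemma Delta_u_bound (R : realType) d n s : (n < 2 ^ s)%N ->
  (Delta_u R d n <= (kalai_kleitman s d)%:R%:E)%E.
Proof.
move=> ns; apply: ge_ereal_sup => _ [m [P [Ppoly _ Pd cardF ->]]].
have [k [a [b [E [I [-> <- In]]]]]] := facet_presentation Ppoly Pd cardF.
by apply: diameter_solutions; apply: leq_ltn_trans ns.
Qed.

(** * The logarithm of the bound *)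

Lemma kalai_kleitman_step s d M B : (minn d (2 ^ s) <= M)%N -> (0 < M)%N ->
  (kalai_kleitman s d < B)%N -> (kalai_kleitman s.+1 d < 4 * M * B)%N.
Proof.
move=> dM M0 sB /=.
have : (minn d (2 ^ s) * (2 * kalai_kleitman s d + 2) <= M * (2 * B))%N.
  by apply: leq_mul => //; lia.
nia.
Qed.

(** The first t doublings contribute factors 4 * 2^j with j < t, whose product is
    2^(2 * t + 'C(t, 2)), and the r further ones contribute 4 * 2^t each. *)
Lemma kalai_kleitman_pow2 t r d : (d <= 2 ^ t)%N ->
  (kalai_kleitman (t + r) d < 2 ^ (2 * (t + r) + 'C(t, 2) + t * r))%N.
Proof.
move=> dt.
have start : (kalai_kleitman t d < 2 ^ (2 * t + 'C(t, 2)))%N.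
  elim: t {dt} => [|t IH]; first by [].
  apply: leq_trans (kalai_kleitman_step (geq_minr _ _) _ IH) _; rewrite ?expn_gt0 //.
  rewrite -[4%N]/(2 ^ 2)%N -!expnD leq_exp2l // binS bin1; lia.
elim: r => [|r IH]; first by rewrite muln0 !addn0.
rewrite addnS.
apply: leq_trans (kalai_kleitman_step (leq_trans (geq_minl _ _) dt) _ IH) _.
  by rewrite expn_gt0.
rewrite -[4%N]/(2 ^ 2)%N -!expnD leq_exp2l //; lia.
Qed.

Lemma bin2_double t : (2 * 'C(t, 2) + t = t * t)%N.
Proof. by elim: t => // t IH; rewrite binS bin1; lia. Qed.

Section Log2.
Variable R : realType.
Implicit Types x y : R.

Lemma ln2_gt0 : 0 < ln 2 :> R.
Proof. by rewrite ln_gt0 // ltr1n. Qed.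

Lemma log2M x y : 0 < x -> 0 < y -> log2 (x * y) = log2 x + log2 y.
Proof. by move=> x0 y0; rewrite /log2 lnM // mulrDl. Qed.

Lemma log2X (p : nat) : log2 (2 ^+ p : R) = p%:R.
Proof.
by rewrite /log2 lnXn // -[ln 2 *+ p]mulr_natl mulfK // gt_eqF // ln2_gt0.
Qed.

Lemma log2_2 : log2 (2 : R) = 1.
Proof. by rewrite -[2 : R]expr1 log2X. Qed.

Lemma log2_le x y : 0 < x -> x <= y -> log2 x <= log2 y.
Proof.
move=> x0 xy; rewrite /log2 ler_pM2r ?invr_gt0 ?ln2_gt0 //.
by rewrite ler_ln // posrE ?(lt_le_trans x0).
Qed.

Lemma powR_log2 x c e : 0 < x -> c * log2 x = e -> x `^ c = 2 `^ e.
Proof.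
move=> x0 <-; rewrite /powR (gt_eqF x0) pnatr_eq0 /=; congr expR.
by rewrite -mulrA /log2 divfK // gt_eqF // ln2_gt0.
Qed.
End Log2.

(** With l = log2 d and L = log2 n this bounds the exponent of
    [kalai_kleitman_pow2] whenever l <= t <= l + 1 and t + r <= L + 1, that is
    for the logarithms rounded to integers. *)
Definition budget (R : realType) (l L : R) : R :=
  2 * (L + 1) + (l + 1) * (L + 1) - l ^+ 2 / 2.

Lemma Delta_u_budget (R : realType) d n : (0 < d)%N -> (d <= n)%N ->
  (Delta_u R d n <= (2 `^ budget (log2 d%:R) (log2 n%:R))%:E)%E.
Proof.
move=> d0 dn; set t := up_log 2 d; set s := (trunc_log 2 n).+1.
have n0 : (0 < n)%N by apply: leq_trans dn.
have dt : (d <= 2 ^ t)%N by apply: up_logP.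
have ns : (n < 2 ^ s)%N by apply: trunc_log_ltn.
have ts : (t <= s)%N by apply: up_log_min => //; apply/ltnW/(leq_ltn_trans dn).
apply: le_trans (Delta_u_bound R d ns) _; rewrite lee_fin.
have := kalai_kleitman_pow2 (s - t) dt; rewrite subnKC // => lt.
set l := log2 d%:R; set L := log2 n%:R.
have l0 : 0 <= l by rewrite -[0](log2X R 0) log2_le // ler1n.
have lt_ : l <= t%:R.
  by rewrite -log2X; apply: log2_le; rewrite ?ltr0n // -natrX ler_nat.
have tl : t%:R <= l + 1.
  have [d1|d1] := leqP d 1.
    by rewrite /t (_ : d = 1)%N ?up_log1 ?addr_ge0 //; lia.
  have := @up_log_gtn 2 d isT d1; rewrite -/t => h.
  have {h} : log2 (2 ^+ t.-1) <= l.
    by apply: log2_le; rewrite ?exprn_gt0 // -natrX ler_nat ltnW.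
  have t0 : (0 < t)%N by rewrite lt0n; apply: contraTneq dt => ->; rewrite -ltnNge.
  by rewrite log2X -lerBlDr -[in t%:R](prednK t0) -natr1 addrK.
have sL : s%:R <= L + 1.
  rewrite -natr1 lerD2r -log2X; apply: log2_le; rewrite ?exprn_gt0 //.
  by rewrite -natrX ler_nat; apply: trunc_logP.
apply: (@le_trans _ _ (2 ^+ (2 * s + 'C(t, 2) + t * (s - t)))).
  by rewrite -natrX ler_nat ltnW.
rewrite -powR_mulrn //; apply: ler_powR; first by rewrite ler1n.
rewrite !natrD !natrM natrB //.
have := congr1 (fun p : nat => p%:R : R) (bin2_double t).
rewrite natrD !natrM /budget; set c := ('C(t, 2))%:R => ct.
have tsL : t%:R * s%:R <= (l + 1) * (L + 1) :> R by apply: ler_pM.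
have tt : l ^+ 2 <= t%:R ^+ 2 by rewrite lerXn2r ?nnegrE.
have tR : 0 <= t%:R :> R by [].
rewrite expr2 in tt *; rewrite expr2 in tt; nra.
Qed.

(** * Asymptotics *)

Local Open Scope classical_set_scope.
Local Open Scope ring_scope.

Lemma log2_cvgy (R : realType) : (fun d : nat => log2 (d%:R : R)) @ \oo --> +oo.
Proof.
apply/cvgryPge => A; near=> d.
have h : 2 `^ A <= (d%:R : R) by near: d; apply: nbhs_infty_ger.
apply: le_trans (log2_le _ h); last by rewrite powR_gt0.
by rewrite /log2 ln_powR mulfK // gt_eqF // ln2_gt0.
Unshelve. all: by end_near. Qed.

Section Growth.
Variables (R : realType) (gamma : R) (n : nat -> nat) (eps : nat -> R).
Hypotheses (gamma_gt0 : 0 < gamma) (gamma_lt1 : gamma < 1).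
Hypothesis eps0 : eps @ \oo --> (0 : R).
Hypothesis nE : \forall d \near \oo, (n d)%:R = d%:R `^ (gamma^-1 + eps d).

Let l d : R := log2 d%:R.
Let L d : R := log2 (n d)%:R.
Let M d : R := log2 ((n d)%:R - d%:R).
Let U d : R := budget (l d) (L d).

Lemma l_ge A : \forall d \near \oo, A <= l d.
Proof. by move: A; apply/cvgryPge; apply: log2_cvgy. Qed.

Lemma l_inv : (fun d => (l d)^-1) @ \oo --> (0 : R).
Proof.
apply/(gtr0_cvgV0 _); last exact: log2_cvgy.
by near=> d; apply: lt_le_trans ltr01 _; near: d; apply: l_ge.
Unshelve. all: by end_near. Qed.

Lemma L_l : (fun d => L d / l d) @ \oo --> gamma^-1.
Proof.
rewrite -[gamma^-1]addr0.
apply: cvg_trans (cvgD (cvg_cst gamma^-1) eps0); apply: near_eq_cvg.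
near=> d; have l1 : 1 <= l d by near: d; apply: l_ge.
rewrite /L /= (near nE d) // /log2 ln_powR -[_ * ln _ / ln 2]mulrA.
by rewrite -[_ / ln 2]/(l d) mulfK // gt_eqF // (lt_le_trans ltr01).
Unshelve. all: by end_near. Qed.

(** Since 1 / gamma > 1, the gap between log2 n and log2 d grows without bound. *)
Lemma n_ge : \forall d \near \oo, (0 < d)%N /\ (2 * d <= n d)%N.
Proof.
have g1 : 1 < gamma^-1 by rewrite invf_gt1.
pose c := (1 + gamma^-1) / 2.
have c1 : 1 < c by rewrite /c; lra.
have cg : c < gamma^-1 by rewrite /c; lra.
near=> d; have d0 : (0 < d)%N by near: d; apply: nbhs_infty_gt.
split=> //.
have l1 : 1 <= l d by near: d; apply: l_ge.
have l2 : 2 / (c - 1) <= l d by near: d; apply: l_ge.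
have Lc : c <= L d / l d.
  by apply: ltW; near: d; apply: (cvgr_gt _ L_l).
have lL : l d + 2 <= L d.
  move: Lc; rewrite ler_pdivlMr ?(lt_le_trans ltr01) // => Lc.
  have : 2 <= (c - 1) * l d by rewrite mulrC -ler_pdivrMr ?subr_gt0.
  lra.
have n0 : (0 < n d)%N.
  rewrite lt0n; apply/eqP => n0; move: lL.
  by rewrite /L n0 /log2 ln0 ?lexx // mul0r; lra.
rewrite leqNgt; apply/negP => /ltnW nd.
have : L d <= log2 (2 * d%:R) by apply: log2_le; rewrite ?ltr0n // -natrM ler_nat.
rewrite log2M ?ltr0n // -/(l d) log2_2; lra.
Unshelve. all: by end_near. Qed.

(** As n >= 2 d, log2 (n - d) lies between log2 n - 1 and log2 n. *)
Lemma M_l : (fun d => M d / l d) @ \oo --> gamma^-1.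
Proof.
have lo : (fun d => L d / l d - (l d)^-1) @ \oo --> gamma^-1.
  by rewrite -[gamma^-1]subr0; apply: cvgB L_l l_inv.
apply: (squeeze_cvgr _ lo L_l); near=> d.
have l1 : 1 <= l d by near: d; apply: l_ge.
have [d0 dn] : (0 < d)%N /\ (2 * d <= n d)%N by near: d; apply: n_ge.
have l0 : 0 < (l d)^-1 by rewrite invr_gt0 (lt_le_trans ltr01).
have n0 : 0 < (n d)%:R :> R by rewrite ltr0n; lia.
have d2 : 2 * d%:R <= (n d)%:R :> R by rewrite -natrM ler_nat.
have d0' : 0 < d%:R :> R by rewrite ltr0n.
have LM : L d - 1 <= M d.
  rewrite lerBlDr -(log2_2 R) addrC -log2M // ?subr_gt0; last by lra.
  by apply: log2_le => //; lra.
have ML : M d <= L d by apply: log2_le; lra.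
apply/andP; split; last by rewrite ler_pM2r.
by rewrite -[X in _ - X]mul1r -mulrBl ler_pM2r.
Unshelve. all: by end_near. Qed.

Lemma U_l2 : (fun d => U d / l d ^+ 2) @ \oo --> gamma^-1 - 1 / 2.
Proof.
pose q d := L d / l d; pose z d := (l d)^-1.
have lim : (fun d => 2 * ((q d + z d) * z d) + (1 + z d) * (q d + z d) - 1 / 2)
    @ \oo --> 2 * ((gamma^-1 + 0) * 0) + (1 + 0) * (gamma^-1 + 0) - 1 / 2.
  apply: cvgB; last exact: cvg_cst.
  have qz : (fun d => q d + z d) @ \oo --> gamma^-1 + 0.
    exact: cvgD L_l l_inv.
  have qzz : (fun d => (q d + z d) * z d) @ \oo --> (gamma^-1 + 0) * 0.
    exact: cvgM qz l_inv.
  have z1 : (fun d => 1 + z d) @ \oo --> 1 + (0 : R).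
    by apply: cvgD l_inv; apply: cvg_cst.
  by apply: cvgD (cvgM z1 qz); apply: cvgM qzz; apply: cvg_cst.
have -> : gamma^-1 - 1 / 2 =
    2 * ((gamma^-1 + 0) * 0) + (1 + 0) * (gamma^-1 + 0) - 1 / 2 by ring.
apply: cvg_trans lim; apply: near_eq_cvg; near=> d.
have l1 : 1 <= l d by near: d; apply: l_ge.
have l0 : l d != 0 by rewrite gt_eqF // (lt_le_trans ltr01).
by rewrite /q /z /U /budget; field.
Unshelve. all: by end_near. Qed.

Lemma Delta_u_near : \forall d \near \oo,
  (Delta_u R d (n d) <= (2 `^ U d)%:E)%E.
Proof.
near=> d; have [d0 dn] : (0 < d)%N /\ (2 * d <= n d)%N by near: d; apply: n_ge.
by apply: Delta_u_budget => //; lia.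
Unshelve. all: by end_near. Qed.

Lemma M_ge1 : \forall d \near \oo,
  [/\ 1 <= l d, 1 <= M d & 0 < (n d)%:R - d%:R :> R].
Proof.
near=> d; have l1 : 1 <= l d by near: d; apply: l_ge.
have [d0 dn] : (0 < d)%N /\ (2 * d <= n d)%N by near: d; apply: n_ge.
have d2 : 2 * d%:R <= (n d)%:R :> R by rewrite -natrM ler_nat.
have d0' : 0 < d%:R :> R by rewrite ltr0n.
have lM : l d <= M d by apply: log2_le; lra.
by split; lra.
Unshelve. all: by end_near. Qed.

(** The error term is chosen so that the right-hand side is 2 `^ U d exactly;
    then only its limit has to be computed. *)
Lemma first_form : exists e : nat -> R, e @ \oo --> (0 : R) /\
  \forall d \near \oo, (Delta_u R d (n d) <=
    (((n d)%:R - d%:R) `^ ((1 - gamma / 2 + e d) * log2 d%:R))%:E)%E.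
Proof.
pose X d := (U d / l d ^+ 2) / (M d / l d).
exists (fun d => X d - (1 - gamma / 2)); split.
  have g0 : gamma^-1 != 0 by rewrite invr_eq0 gt_eqF.
  have -> : (0 : R) = (gamma^-1 - 1 / 2) / gamma^-1 - (1 - gamma / 2).
    by field; rewrite gt_eqF.
  by apply: cvgB; [apply: cvgM U_l2 _; apply: cvgV M_l|exact: cvg_cst].
near=> d; have [l1 M1 nd] : [/\ 1 <= l d, 1 <= M d & 0 < (n d)%:R - d%:R :> R].
  by near: d; apply: M_ge1.
rewrite (@powR_log2 R _ _ (U d) nd); first by near: d; apply: Delta_u_near.
rewrite -/(l d) -/(M d) /X; field.
by rewrite !gt_eqF // (lt_le_trans ltr01).
Unshelve. all: by end_near. Qed.

Lemma second_form : exists e : nat -> R, e @ \oo --> (0 : R) /\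
  \forall d \near \oo, (Delta_u R d (n d) <=
    (((n d)%:R - d%:R) `^ ((1 / 2 - (1 - gamma) ^+ 2 / 2 + e d)
       * log2 ((n d)%:R - d%:R)))%:E)%E.
Proof.
pose X d := (U d / l d ^+ 2) / (M d / l d) / (M d / l d).
exists (fun d => X d - (1 / 2 - (1 - gamma) ^+ 2 / 2)); split.
  have g0 : gamma^-1 != 0 by rewrite invr_eq0 gt_eqF.
  have -> : (0 : R) = (gamma^-1 - 1 / 2) / gamma^-1 / gamma^-1 -
      (1 / 2 - (1 - gamma) ^+ 2 / 2).
    by field; rewrite gt_eqF.
  apply: cvgB; [apply: cvgM; last exact: cvgV M_l|exact: cvg_cst].
  by apply: cvgM U_l2 _; apply: cvgV M_l.
near=> d; have [l1 M1 nd] : [/\ 1 <= l d, 1 <= M d & 0 < (n d)%:R - d%:R :> R].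
  by near: d; apply: M_ge1.
rewrite (@powR_log2 R _ _ (U d) nd); first by near: d; apply: Delta_u_near.
rewrite -/(M d) /X; field.
by rewrite !gt_eqF // (lt_le_trans ltr01).
Unshelve. all: by end_near. Qed.
End Growth.

Theorem theorem15 (R : realType) (gamma : R) (n : nat -> nat)
  (hgamma0 : 0 < gamma) (hgamma1 : gamma < 1)
  (hn : exists eps : nat -> R, eps @ \oo --> (0 : R) /\
    \forall d \near \oo, (n d)%:R = d%:R `^ (gamma^-1 + eps d)) :
  (exists eps : nat -> R, eps @ \oo --> (0 : R) /\
    \forall d \near \oo,
      (Delta_u R d (n d) <=
        (((n d)%:R - d%:R) `^
          ((1 - gamma / 2 + eps d) * log2 d%:R))%:E)%E) /\
  (exists eps : nat -> R, eps @ \oo --> (0 : R) /\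
    \forall d \near \oo,
      (Delta_u R d (n d) <=
        (((n d)%:R - d%:R) `^
          ((1 / 2 - (1 - gamma) ^+ 2 / 2 + eps d)
            * log2 ((n d)%:R - d%:R)))%:E)%E).
Proof.
have [eps [eps0 nE]] := hn; split.
  exact: first_form hgamma0 hgamma1 eps0 nE.
exact: second_form hgamma0 hgamma1 eps0 nE.
Qed.
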